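(* Let $m\ge2$, let $\lambda\in\mathbb{N}^m$ be a partition, let $\ell\geq d(\lambda)$ be a positive integer, and let $z=(z_1,\ldots,z_{|\lambda|})$ be pairwise distinct complex numbers. Then for every admissible partitioning $\mathcal{U}=\{U_1,\ldots,U_\ell\}$ of $\{1,\ldots,|\lambda|\}$ (as defined in the context), $$Q(\mathcal{U})\in CB^\ell_z(\lambda).$$
   Context: $\mathbb{N}=\{0,1,2,\ldots\}$. For a partition $\lambda=(\lambda_1\geq\cdots\geq\lambda_m)\in\mathbb{N}^m$, $m\ge 2$, write $|\lambda|=\sum_i\lambda_i$ and $d(\lambda)=\lambda_1-\lambda_m$. Let $V^{\otimes|\lambda|}$ denote the space of complex polynomials in the variables $y^{(j)}_a$ ($1\le j\le m$, $1\le a\le|\lambda|$) that are homogeneous of degree 1 in the $m$-tuple $y^{(1)}_a,\ldots,y^{(m)}_a$ for each $a$. Put $$e_{i,j}=\sum_{a=1}^{|\lambda|}y^{(i)}_a\frac{\partial}{\partial y^{(j)}_a},\qquad e^{z}_{i,j}=\sum_{a=1}^{|\lambda|}z_a\,y^{(i)}_a\frac{\partial}{\partial y^{(j)}_a}.$$ Let $SV(\lambda)=\{p\in V^{\otimes|\lambda|} : e_{i,j}p=0 \text{ for } 1\le i<j\le m,\ e_{i,i}p=\lambda_i p \text{ for } 1\le i\le m\}$, and for a positive integer $\ell\geq d(\lambda)$ define the space of conformal blocks at level $\ell$, $$CB^\ell_z(\lambda)=\{p\in SV(\lambda) : (e^z_{1,m})^{\ell-d(\lambda)+1}p=0\}.$$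 For finite index sets $I,J$, let $R(z_I|z_J)=\prod_{a\in I}\prod_{b\in J}(z_a-z_b)$ and $R(z_{I_1}|\ldots|z_{I_m})=\prod_{i<j}R(z_{I_i}|z_{I_j})$. For a partition $\mu\in\mathbb{N}^m$ define $$P_z(\mu)=\sum_{(I_1,\ldots,I_m)}\frac{\prod_{j=1}^m \prod_{a\in I_j}y^{(j)}_a}{R(z_{I_1}|\ldots|z_{I_m})},$$ the sum over ordered tuples of pairwise disjoint sets with $\bigcup_jI_j=\{1,\ldots,|\mu|\}$, $|I_j|=\mu_j$. For pairwise different integers $k_1,\ldots,k_{|\mu|}$, let $P^{(k_1,\ldots,k_{|\mu|})}(\mu)$ be obtained from $P_z(\mu)$ by substituting $y^{(j)}_{k_a}$ for $y^{(j)}_a$ and $z_{k_a}$ for $z_a$ for all $j,a$. Put formally $\lambda_0=\ell+\lambda_m$. A partitioning $\mathcal{U}=\{U_1,\ldots,U_\ell\}$ of $\{1,\ldots,|\lambda|\}$ into $\ell$ (possibly empty) subsets is called admissible if for every $j=0,\ldots,m-1$ exactly $\lambda_j-\lambda_{j+1}$ of the sets $U_i$ satisfy $|U_i|\equiv j \pmod m$. Each $U_j$ is regarded as an ordered set with the natural order of integers. Let $\mu^{(j)}\in\mathbb{N}^m$ be the unique partition with $|\mu^{(j)}|=|U_j|$ and $d(\mu^{(j)})\in\{0,1\}$. Define $$Q(\mathcal{U})=\prod_{j=1}^{\ell}P^{(U_j)}(\mu^{(j)}).$$ *)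

(* Defs.v *)
From mathcomp Require Import all_boot all_order all_algebra.
From mathcomp Require Import zify mpoly.

Set Implicit Arguments.
Unset Strict Implicit.
Unset Printing Implicit Defensive.

Import GRing.Theory.
Local Open Scope ring_scope.

(* Indices are shifted by one: 1 <= j <= m and 1 <= a <= n become j : 'I_m and
   a : 'I_n, and lambda_j is the entry number j - 1 of the tuple. *)

Section Partitions.
Local Open Scope nat_scope.

Definition is_partition m (mu : m.-tuple nat) : bool := sorted geq mu.

Definition pdiff m (mu : m.-tuple nat) : nat := head 0 mu - last 0 mu.

Definition is_balanced m n (mu : m.-tuple nat) : bool :=
  [&& is_partition mu, sumn mu == n & pdiff mu <= 1].

Lemma balanced_exists m n : 0 < m -> exists mu : m.-tuple nat, is_balanced n mu.
Proof.
move=> m_gt0; pose f i := n %/ m + (i < n %% m).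
exists [tuple f i | i < m]; apply/and3P.
have szE : size (map f (iota 0 m)) = m by rewrite size_map size_iota.
have tE : tval [tuple f i | i < m] = map f (iota 0 m).
  by rewrite -val_enum_ord -map_comp.
have r_lt : n %% m < m by rewrite ltn_mod.
split; rewrite /is_partition /pdiff tE.
- rewrite sorted_map; apply: sub_sorted (iota_sorted 0 m) => i j /= le_ij.
  by rewrite /f leq_add2l; do 2 case: ltnP => //=; lia.
- have -> : sumn (map f (iota 0 m)) = \sum_(0 <= i < m) f i.
    by rewrite sumnE big_map /index_iota subn0.
  rewrite big_split /= sum_nat_const_nat subn0.
  rewrite (@big_cat_nat _ _ _ (n %% m)) ?(ltnW r_lt) //=.
  rewrite [X in _ + (X + _)](eq_big_nat _ _ (F2 := fun=> 1)); last first.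
    by move=> i /andP[_ ->].
  rewrite [X in _ + (_ + X)](eq_big_nat _ _ (F2 := fun=> 0)); last first.
    by move=> i /andP[ri _]; rewrite ltnNge ri.
  by rewrite !sum_nat_const_nat subn0 muln1 muln0 addn0 mulnC -divn_eq.
- rewrite -nth0 -nth_last szE !(nth_map 0) ?size_iota ?prednK //.
  by rewrite /f; do 2 case: ltnP => //=; lia.
Qed.

Lemma balanced_uniq m n (mu nu : m.-tuple nat) :
  is_balanced n mu -> is_balanced n nu -> mu = nu.
Proof.
case: m mu nu => [|m] mu nu; first by rewrite (tuple0 mu) (tuple0 nu).
have geqT : transitive geq by move=> x y z /= xy yz; apply: leq_trans yz xy.
have bnd (t : m.+1.-tuple nat) : is_balanced n t ->
    forall i, i <= m -> last 0 t <= nth 0 t i <= head 0 t.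
  case/and3P=> st _ _ i lim; rewrite -nth_last -nth0 size_tuple /=.
  by apply/andP; split; apply: (sorted_leq_nth geqT (fun x => leqnn x) 0 st);
    rewrite ?inE ?size_tuple.
have sumE (t : m.+1.-tuple nat) : sumn t = \sum_(0 <= i < m.+1) nth 0 t i.
  by rewrite sumnE (big_nth 0) size_tuple.
have mono (t : m.+1.-tuple nat) : is_balanced n t ->
    forall i j, i <= j -> j <= m -> nth 0 t j <= nth 0 t i.
  case/and3P=> st _ _ i j lij ljm.
  by apply: (sorted_leq_nth geqT (fun x => leqnn x) 0 st);
    rewrite ?inE ?size_tuple // ltnS ?(leq_trans lij).
(* at the first index where two balanced tuples differ, one dominates *)
have dom (s t : m.+1.-tuple nat) : is_balanced n s -> is_balanced n t ->
    forall i, i <= m -> nth 0 s i < nth 0 t i -> False.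
  move=> bs bt i lim lt_i.
  have ds : head 0 s - last 0 s <= 1 by case/and3P: bs.
  have dt : head 0 t - last 0 t <= 1 by case/and3P: bt.
  have les j : j <= m -> nth 0 s j <= nth 0 t j.
    move=> ljm; have := bnd _ bs _ ljm; have := bnd _ bt _ ljm.
    have := bnd _ bs _ lim; have := bnd _ bt _ lim.
    case: (leqP i j) => [lij|/ltnW lji].
      by have := mono _ bs _ _ lij ljm; lia.
    by have := mono _ bt _ _ lji lim; lia.
  have : sumn s < sumn t.
    rewrite !sumE !big_mkord (bigD1 (Ordinal (lim : i < m.+1))) //=.
    rewrite [X in _ < X](bigD1 (Ordinal (lim : i < m.+1))) //= -addSn.
    by apply: leq_add => //; apply: leq_sum => j _; apply: les; rewrite -ltnS.
  by case/and3P: bs => _ /eqP-> _; case/and3P: bt => _ /eqP-> _; rewrite ltnn.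
move=> bmu bnu; apply: val_inj; apply: (@eq_from_nth _ 0); rewrite ?size_tuple //.
move=> i lim; case: (ltngtP (nth 0 mu i) (nth 0 nu i)) => // lt_i.
  by case: (dom _ _ bmu bnu i lim lt_i).
by case: (dom _ _ bnu bmu i lim lt_i).
Qed.

(* The unique partition mu in N^m with |mu| = n and d(mu) in {0, 1}. *)
Definition balanced m (m_gt0 : 0 < m) n : m.-tuple nat :=
  xchoose (balanced_exists n m_gt0).

(* The level enters through the convention lambda_0 = l + lambda_m, so that
   entry number j of [ext_part l lam] is lambda_j for 0 <= j <= m. *)
Definition ext_part m (l : nat) (lam : m.-tuple nat) : seq nat :=
  (l + last 0 lam) :: lam.

Definition is_partitioning n l (U : 'I_l -> {set 'I_n}) : Prop :=
  (forall i j, i != j -> [disjoint U i & U j]) /\ \bigcup_i U i = [set: 'I_n].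

Definition admissible m n l (lam : m.-tuple nat) (U : 'I_l -> {set 'I_n}) : Prop :=
  is_partitioning U /\
  forall j, j < m ->
    #|[set i | #|U i| == j %[mod m]]|
      = nth 0 (ext_part l lam) j - nth 0 (ext_part l lam) j.+1.

(* The tuples (I_1, ..., I_m) over which P_z(mu) is summed. *)
Definition is_splitting m n (mu : m.-tuple nat) (I : {ffun 'I_m -> {set 'I_n}}) :
    bool :=
  [&& [forall i, forall j, (i != j) ==> [disjoint I i & I j]],
      \bigcup_j I j == [set: 'I_n]
    & [forall j, #|I j| == tnth mu j]].

End Partitions.

Section ConformalBlocks.
Variables (C : fieldType) (m : nat).

Section Operators.
Variable n : nat.

(* The variables y^(i)_a are the m * n indeterminates, listed row by row. *)
Definition yidx (i : 'I_m) (a : 'I_n) : 'I_(m * n) := mxvec_index i a.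

Definition yvar (i : 'I_m) (a : 'I_n) : {mpoly C[m * n]} := 'X_(yidx i a).

Definition in_tensor (p : {mpoly C[m * n]}) : Prop :=
  forall (a : 'I_n) (mon : 'X_{1..m * n}),
    mon \in msupp p -> (\sum_(i < m) mon (yidx i a))%N = 1%N.

Definition e_op (i j : 'I_m) (p : {mpoly C[m * n]}) : {mpoly C[m * n]} :=
  \sum_(a < n) yvar i a * mderiv (yidx j a) p.

Definition ez_op (z : 'I_n -> C) (i j : 'I_m) (p : {mpoly C[m * n]}) :
    {mpoly C[m * n]} :=
  \sum_(a < n) z a *: (yvar i a * mderiv (yidx j a) p).

Definition in_SV (lam : m.-tuple nat) (p : {mpoly C[m * n]}) : Prop :=
  [/\ in_tensor p,
      forall i j : 'I_m, (i < j)%N -> e_op i j p = 0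
    & forall i : 'I_m, e_op i i p = (tnth lam i)%:R *: p].

End Operators.

Definition Rfactor n (z : 'I_n -> C) (I J : {set 'I_n}) : C :=
  \prod_(a in I) \prod_(b in J) (z a - z b).

Definition Rprod n (z : 'I_n -> C) (I : 'I_m -> {set 'I_n}) : C :=
  \prod_(i < m) \prod_(j < m | (i < j)%N) Rfactor z (I i) (I j).

(* P_z(mu); meant for n = |mu|, otherwise the sum is empty. *)
Definition Ppoly n (z : 'I_n -> C) (mu : m.-tuple nat) : {mpoly C[m * n]} :=
  \sum_(I : {ffun 'I_m -> {set 'I_n}} | is_splitting mu I)
    (Rprod z I)^-1 *: \prod_(j < m) \prod_(a in I j) yvar j a.

(* P^(k_1, ..., k_n)(mu): y^(j)_a and z_a become y^(j)_(k a) and z_(k a). *)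
Definition Psubst N n (z : 'I_N -> C) (k : 'I_n -> 'I_N) (mu : m.-tuple nat) :
    {mpoly C[m * N]} :=
  Ppoly (z \o k) mu
    \mPo [tuple mxvec (\matrix_(j < m, a < n) yvar j (k a)) 0 t | t < m * n].

Hypothesis m_ge2 : (2 <= m)%N.

Let m_gt0 : (0 < m)%N := ltnW m_ge2.

Definition first_idx : 'I_m := Ordinal m_gt0.

Lemma last_idx_subproof : (m.-1 < m)%N.
Proof. by rewrite ltn_predL. Qed.

Definition last_idx : 'I_m := Ordinal last_idx_subproof.

Definition in_CB n (l : nat) (z : 'I_n -> C) (lam : m.-tuple nat)
    (p : {mpoly C[m * n]}) : Prop :=
  in_SV lam p /\ iter (l - pdiff lam + 1) (ez_op z first_idx last_idx) p = 0.

(* [enum_val] lists the elements of U j : {set 'I_n} in increasing order. *)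
Definition Qpoly n l (z : 'I_n -> C) (U : 'I_l -> {set 'I_n}) : {mpoly C[m * n]} :=
  \prod_(j < l)
    Psubst z (fun a : 'I_#|U j| => enum_val a) (balanced m_gt0 #|U j|).

End ConformalBlocks.

(* Main.v *)
(** The operators e_{i,j} and e^z_{i,j} are derivations, so everything reduces to
the factors P_z(mu) with d(mu) <= 1.  Write P_z(mu) as a sum over colorings of the
indices.  For i < j and e = 0, 1, the coefficient of a coloring h in the image of
P_z(mu) under the derivation weighted by z^e is, up to a sign and the factor 1/R(h),
the sum over the mu_i + 1 indices a of color i of q(z_a) / prod_b (z_a - z_b), with
q monic of degree mu_j - 1 + e.  By Lagrange interpolation this is the coefficient
of degree mu_i in q.  Hence the image is 0 if mu_j + e <= mu_i, and a multiple of
P_z(mu + eps_i - eps_j) if mu_j + e = mu_i + 1.  Consequently e_{i,j} kills P_z(mu)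
for i < j, and e^z_{1,m} kills P_z(mu) if d(mu) = 1, whereas its square does if
d(mu) = 0.  Exactly l - d(lambda) factors of Q(U) have d = 0, so by Leibniz' rule
the power l - d(lambda) + 1 of e^z_{1,m} kills Q(U). *)

From HB Require Import structures.
Require Import Defs.
From mathcomp Require Import all_boot all_order all_algebra.
From mathcomp Require Import mpoly complex reals.
From mathcomp Require Import zify ring.

Set Implicit Arguments.
Unset Strict Implicit.
Unset Printing Implicit Defensive.

Import GRing.Theory.
Local Open Scope ring_scope.

(** * Leibniz rules for the operators, and degrees in each group of variables *)

Section Derivations.
Variables (C : fieldType) (m N : nat).
Implicit Types (w : 'I_N -> C) (i j s : 'I_m) (p q : {mpoly C[m * N]}).

Lemma yidx_inj i j (a b : 'I_N) : (yidx i a == yidx j b) = (i == j) && (a == b).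
Proof.
apply/eqP/andP => [eq_ij|[/eqP-> /eqP->]] //.
(* A matrix whose entries are their own index pairs lets [mxvec] recover the pair from its
   position. *)
have := mxvecE (\matrix_(s < m, c < N) (s, c)) i a.
by rewrite -/(yidx i a) eq_ij mxvecE !mxE => -[-> ->].
Qed.

Lemma ez_op_is_linear w i j : linear (ez_op w i j).
Proof.
move=> c p q; rewrite /ez_op scaler_sumr -big_split; apply: eq_bigr => a _ /=.
by rewrite mderivD mderivZ mulrDr scalerDr -scalerAr !scalerA mulrC.
Qed.

HB.instance Definition _ w i j :=
  GRing.isLinear.Build C {mpoly C[m * N]} {mpoly C[m * N]} _ (ez_op w i j)
    (ez_op_is_linear w i j).

(** Lets the results on [ez_op] serve for [e_op] too. *)
Lemma e_opE i j p : e_op i j p = ez_op (fun=> 1) i j p.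
Proof. by apply: eq_bigr => a _; rewrite scale1r. Qed.

Lemma ez_opM w i j p q : ez_op w i j (p * q) = ez_op w i j p * q + p * ez_op w i j q.
Proof.
rewrite /ez_op mulr_suml mulr_sumr -big_split; apply: eq_bigr => a _ /=.
rewrite mderivM mulrDr scalerDr -scalerAl -scalerAr !mulrA.
by rewrite (mulrC p (yvar C i a)).
Qed.

Lemma ez_op1 w i j : ez_op w i j 1 = 0.
Proof.
by rewrite /ez_op big1 // => a _; rewrite -mpolyC1 mderivC mulr0 scaler0.
Qed.

Lemma ez_op_yvar w i j s b :
  ez_op w i j (yvar C s b) = if s == j then w b *: yvar C i b else 0.
Proof.
rewrite /ez_op; under eq_bigr => a _ do rewrite mderivX mnm1E yidx_inj.
case: eqP => [->|_]; last first.
  by rewrite big1 // => a _; rewrite scale0r mulr0 scaler0.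
rewrite (bigD1 b) //= eqxx scale1r big1 ?addr0; last first.
  by move=> a /negPf; rewrite eq_sym => ->; rewrite scale0r mulr0 scaler0.
have -> : (U_(yidx j b) - U_(yidx j b))%MM = 0%MM :> 'X_{1..m * N}.
  by apply/mnmP => t; rewrite mnmBE subnn mnm0E.
by rewrite mpolyX0 mulr1.
Qed.

Lemma ez_op_prod (I : eqType) (r : seq I) (F : I -> {mpoly C[m * N]}) w i j :
  uniq r ->
  ez_op w i j (\prod_(a <- r) F a) =
    \sum_(a <- r) \prod_(b <- r) (if b == a then ez_op w i j (F a) else F b).
Proof.
elim: r => [|a r IH] /=; first by rewrite !big_nil ez_op1.
case/andP=> a_notin r_uniq.
rewrite !big_cons ez_opM eqxx IH // mulr_sumr; congr (_ * _ + _).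
  rewrite !big_seq; apply: eq_bigr => b b_in.
  by case: eqP => // eq_ba; rewrite -eq_ba b_in in a_notin.
rewrite !big_seq; apply: eq_bigr => b b_in.
rewrite big_cons ifN //; apply: contra a_notin; by move/eqP->.
Qed.

Lemma iter_ez_op0 w i j d : iter d (ez_op w i j) 0 = 0.
Proof. by elim: d => //= d ->; rewrite linear0. Qed.

Lemma iter_ez_opD w i j d p q :
  iter d (ez_op w i j) (p + q) = iter d (ez_op w i j) p + iter d (ez_op w i j) q.
Proof. by elim: d => //= d ->; rewrite linearD. Qed.

(** Each term of the Leibniz expansion applies the operator at least [d1] times to [p] or at least
    [d2] times to [q]. In the induction one application lowers one of the two orders, so that no
    binomial coefficients appear. *)
Lemma iter_ez_opM w i j d d1 d2 p q :
    iter d1 (ez_op w i j) p = 0 -> iter d2 (ez_op w i j) q = 0 ->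
    (d1 + d2 <= d.+1)%N ->
  iter d (ez_op w i j) (p * q) = 0.
Proof.
elim: d d1 d2 p q => [|d IH] d1 d2 p q.
  by case: d1 => [/= ->|[|d1]]; rewrite ?mul0r //; case: d2 => [_ /= ->|//];
    rewrite mulr0.
case: d1 => [p0|d1 Dp]; first by rewrite (p0 : p = 0) mul0r iter_ez_op0.
case: d2 => [q0|d2 Dq le_d]; first by rewrite (q0 : q = 0) mulr0 iter_ez_op0.
rewrite iterSr ez_opM iter_ez_opD.
rewrite (IH d1 d2.+1) ?(IH d1.+1 d2) ?addr0 -?iterSr //; lia.
Qed.

Lemma iter_ez_op_prod (I : Type) (r : seq I) (F : I -> {mpoly C[m * N]})
    (d : I -> nat) w i j :
    (forall x, iter (d x).+1 (ez_op w i j) (F x) = 0) ->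
  iter (\sum_(x <- r) d x).+1 (ez_op w i j) (\prod_(x <- r) F x) = 0.
Proof.
move=> DF; elim: r => [|x r IH]; first by rewrite !big_nil /= ez_op1.
by rewrite !big_cons; apply: (iter_ez_opM (DF x) IH); lia.
Qed.

Lemma ez_op_prod_eq0 (I : Type) (r : seq I) (F : I -> {mpoly C[m * N]}) w i j :
  (forall x, ez_op w i j (F x) = 0) -> ez_op w i j (\prod_(x <- r) F x) = 0.
Proof.
move=> DF; elim: r => [|x r IH]; first by rewrite big_nil ez_op1.
by rewrite big_cons ez_opM DF IH mul0r mulr0 addr0.
Qed.

Lemma ez_op_prod_eigen (I : Type) (r : seq I) (F : I -> {mpoly C[m * N]})
    (c : I -> C) w i j :
    (forall x, ez_op w i j (F x) = c x *: F x) ->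
  ez_op w i j (\prod_(x <- r) F x) = (\sum_(x <- r) c x) *: \prod_(x <- r) F x.
Proof.
move=> DF; elim: r => [|x r IH]; first by rewrite !big_nil ez_op1 scale0r.
by rewrite !big_cons ez_opM DF IH scalerDl -scalerAl -scalerAr.
Qed.

(** Generalizes [in_tensor], the case of [delta] constantly 1, because a single factor of a product
    involves only some of the indices. *)
Definition has_degrees (delta : 'I_N -> nat) p : Prop :=
  forall (a : 'I_N) (mon : 'X_{1..m * N}),
    mon \in msupp p -> (\sum_(i < m) mon (yidx i a))%N = delta a.

Lemma has_degrees_yvar s b : has_degrees (fun a => a == b) (yvar C s b).
Proof.
move=> a mon; rewrite msuppX inE => /eqP->.
under eq_bigr => i _ do rewrite mnm1E yidx_inj.
rewrite (bigD1 s) //= eqxx /= big1 ?addn0 1?eq_sym // => i /negPf.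
by rewrite eq_sym => ->.
Qed.

Lemma has_degreesM delta epsilon p q :
  has_degrees delta p -> has_degrees epsilon q ->
  has_degrees (fun a => delta a + epsilon a)%N (p * q).
Proof.
move=> dp dq a mon /msuppM_le /allpairsP[[m1 m2] /= [in1 in2 ->]].
by under eq_bigr => i _ do rewrite mnmDE; rewrite big_split /= dp ?dq.
Qed.

Lemma has_degrees_prod (I : Type) (r : seq I) (F : I -> {mpoly C[m * N]})
    (delta : I -> 'I_N -> nat) :
    (forall x, has_degrees (delta x) (F x)) ->
  has_degrees (fun a => \sum_(x <- r) delta x a)%N (\prod_(x <- r) F x).
Proof.
move=> dF; elim: r => [|x r IH] a mon.
  by rewrite !big_nil msupp1 inE => /eqP->; rewrite big1 // => i _; rewrite mnm0E.
by rewrite !big_cons; exact: (has_degreesM (dF x) IH).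
Qed.

Lemma has_degrees_lincomb (I : finType) (P : pred I) (c : I -> C)
    (F : I -> {mpoly C[m * N]}) delta :
    (forall x, has_degrees delta (F x)) ->
  has_degrees delta (\sum_(x | P x) c x *: F x).
Proof.
move=> dF a mon /msupp_sum_le /flatten_mapP[x _ /msuppZ_le]; exact: dF.
Qed.

End Derivations.

(* The left-hand side is the coefficient of X^(#|A| - 1) in the Lagrange
   interpolant of q at the nodes z a. *)
Lemma sum_lagrange (C : fieldType) (T : finType) (z : T -> C) (A : {set T})
    (q : {poly C}) :
    injective z -> (size q <= #|A|)%N ->
  \sum_(a in A) q.[z a] / \prod_(b in A :\ a) (z a - z b) = q`_(#|A|.-1).
Proof.
move=> z_inj le_qA.
pose L a := \prod_(b <- enum (A :\ a)) ('X - (z b)%:P).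
pose c a := q.[z a] / \prod_(b in A :\ a) (z a - z b).
have szL a : a \in A -> size (L a) = #|A|.
  by move=> aA; rewrite size_prod_XsubC -cardE (cardsD1 a A) aA.
suff eqL: q = \sum_(a in A) c a *: L a.
  rewrite [in RHS]eqL coef_sum; apply: eq_bigr => a aA; rewrite coefZ.
  have /monicP := monic_prod_XsubC (enum (A :\ a)) xpredT z.
  by rewrite lead_coefE -/(L a) szL // => ->; rewrite mulr1.
apply/eqP; rewrite -subr_eq0; apply/eqP.
apply: (@roots_geq_poly_eq0 _ _ [seq z a | a <- enum A]).
- apply/allP => x /mapP[a]; rewrite mem_enum => aA ->{x}.
  rewrite rootE hornerD hornerN horner_sum (bigD1 a) //= big1 => [|b].
    rewrite addr0 hornerZ horner_prod big_enum /=.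
    under [X in _ - _ * X]eq_bigr do rewrite hornerXsubC.
    rewrite divfK ?subrr // prodf_seq_neq0; apply/allP => b _; apply/implyP.
    by rewrite !inE => /andP[ba _]; rewrite subr_eq0 inj_eq // eq_sym.
  case/andP=> bA ba; rewrite hornerZ horner_prod big_enum /=.
  rewrite (bigD1 a) /=; last by rewrite !inE aA eq_sym ba.
  by rewrite hornerXsubC subrr mul0r mulr0.
- by rewrite map_inj_uniq ?enum_uniq.
rewrite size_map -cardE; apply: leq_trans (size_polyD _ _) _.
rewrite geq_max le_qA size_polyN; apply: leq_trans (size_sum _ _ _) _.
by apply/bigmax_leqP => a aA; rewrite -(szL a aA) size_scale_leq.
Qed.

(** * Action of the derivations on sums over colorings *)

Section Colorings.
Variables (C : fieldType) (m N n : nat) (z : 'I_n -> C) (k : 'I_n -> 'I_N).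
Implicit Types (g h : {ffun 'I_n -> 'I_m}) (mu : 'I_m -> nat) (i j s : 'I_m).

Definition fibre g s : {set 'I_n} := [set a | g a == s].

Definition has_content mu g : bool := [forall s, #|fibre g s| == mu s].

Definition recolor g (a : 'I_n) s : {ffun 'I_n -> 'I_m} :=
  [ffun b => if b == a then s else g b].

(** This is R(z_{I_1}|...|z_{I_m}) for the color classes I_s of [g]. *)
Definition color_disc g : C := \prod_a \prod_(b | (g a < g b)%N) (z a - z b).

Definition color_mon g : {mpoly C[m * N]} := \prod_a yvar C (g a) (k a).

(* P_z(mu) with the ordered set partition (I_1, ..., I_m) encoded as the
   coloring that is j on I_j. *)
Definition color_sum mu : {mpoly C[m * N]} :=
  \sum_(g | has_content mu g) (color_disc g)^-1 *: color_mon g.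

Lemma recolorK g a s t : recolor (recolor g a s) a t = recolor g a t.
Proof. by apply/ffunP => b; rewrite !ffunE; case: eqP. Qed.

Lemma recolor_eq g a s : (recolor g a s == g) = (g a == s).
Proof.
apply/eqP/eqP => [<-|ga]; first by rewrite ffunE eqxx.
by apply/ffunP => b; rewrite ffunE; case: eqP => // ->.
Qed.

Lemma card_fibre g s : #|fibre g s| = (\sum_b (g b == s))%N.
Proof. by rewrite -sum1_card big_mkcond; apply: eq_bigr => b _; rewrite inE. Qed.

Lemma card_fibre_recolor g a i s :
  (#|fibre (recolor g a i) s| + (g a == s) = #|fibre g s| + (i == s))%N.
Proof.
rewrite !card_fibre (bigD1 a) // [in RHS](bigD1 a) //= ffunE eqxx.
rewrite (eq_bigr (fun b => g b == s : nat)); first by rewrite addnC addnA addnAC.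
by move=> b /negPf ba; rewrite ffunE ba.
Qed.

Lemma ez_op_color_mon w i j g :
  ez_op w i j (color_mon g) =
    \sum_(a | g a == j) w (k a) *: color_mon (recolor g a i).
Proof.
rewrite /color_mon ez_op_prod ?index_enum_uniq // [in RHS]big_mkcond /=.
apply: eq_bigr => a _; rewrite ez_op_yvar (bigD1 a) //= eqxx.
case: eqP => _; last by rewrite mul0r.
rewrite (bigD1 a (P := xpredT)) //= ffunE eqxx -scalerAl; congr (_ *: (_ * _)).
by apply: eq_bigr => b /negPf ba; rewrite ffunE ba.
Qed.

Lemma ez_op_color_mon_diag i g :
  ez_op (fun=> 1) i i (color_mon g) = #|fibre g i|%:R *: color_mon g.
Proof.
rewrite ez_op_color_mon -sum1_card natr_sum scaler_suml.
apply: eq_big => [a|a ga]; first by rewrite inE.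
by rewrite (eqP (_ : recolor g a i == g)) ?recolor_eq.
Qed.

Lemma ez_op_color_sum_diag i mu :
  ez_op (fun=> 1) i i (color_sum mu) = (mu i)%:R *: color_sum mu.
Proof.
rewrite /color_sum linear_sum scaler_sumr; apply: eq_bigr => g /forallP/(_ i)/eqP <-.
by rewrite linearZ /= ez_op_color_mon_diag !scalerA mulrC.
Qed.

Lemma has_degrees_color_sum mu :
  has_degrees (fun b => \sum_a (b == k a))%N (color_sum mu).
Proof.
apply: has_degrees_lincomb => g; apply: has_degrees_prod => a.
exact: has_degrees_yvar.
Qed.

(** The second factor collects everything that changes when [a] is recolored. *)
Lemma color_disc_split g a :
  color_disc g =
    (\prod_(x | x != a) \prod_(y | y != a) (if (g x < g y)%N then z x - z y else 1))
    * \prod_(y | y != a)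
        (if (g a < g y)%N then z a - z y else if (g y < g a)%N then z y - z a else 1).
Proof.
rewrite /color_disc (bigD1 a) //= mulrC.
rewrite [X in _ * X = _]big_mkcond [X in _ * X = _](bigD1 a) //= ltnn mul1r.
under eq_bigr => x xa.
  rewrite big_mkcond (bigD1 a) //= mulrC; over.
rewrite big_split /= -mulrA -big_split; congr (_ * _); apply: eq_bigr => y _ /=.
by case: ltngtP; rewrite ?mulr1 ?mul1r.
Qed.

(** Compare the factors that pair [a] with another index y. If y has color below i or above j, the
    factor stays; strictly between, it changes sign. For color j the factor z_a - z_y disappears,
    and for color i the factor z_y - z_a appears. *)
Lemma color_disc_recolor h a i j : (i < j)%N -> h a = i ->
  color_disc (recolor h a j) * \prod_(y in fibre h j) (z a - z y)
    * \prod_(y | (i <= h y < j)%N) (-1)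
  = - (color_disc h * \prod_(y in fibre h i :\ a) (z a - z y)).
Proof.
move=> ij ha; rewrite !(color_disc_split _ a) ffunE eqxx ha.
have -> : \prod_(y in fibre h j) (z a - z y) =
    \prod_(y | y != a) (if h y == j then z a - z y else 1).
  rewrite -big_mkcondr; apply: eq_bigl => y; rewrite inE.
  by case: (eqVneq y a) => // ->; rewrite ha; apply/negbTE; rewrite neq_ltn ij.
have -> : \prod_(y in fibre h i :\ a) (z a - z y) =
    \prod_(y | y != a) (if h y == i then z a - z y else 1).
  by rewrite -big_mkcondr; apply: eq_bigl => y; rewrite !inE.
(* The index [a] has color i and so occurs in the product of signs; its -1 is the sign on the
   right. *)
rewrite [X in _ * X = _](bigD1 a) /= ?ha ?leqnn // mulN1r mulrN; congr (- _).
have -> : \prod_(y | (i <= h y < j)%N && (y != a)) (-1) =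
    \prod_(y | y != a) (if (i <= h y < j)%N then -1 else 1) :> C.
  by rewrite -big_mkcondr; apply: eq_bigl => y; rewrite andbC.
rewrite -!mulrA; congr (_ * _).
  by apply: eq_bigr => x /negPf xa; apply: eq_bigr => y /negPf ya; rewrite !ffunE xa ya.
rewrite -!big_split; apply: eq_bigr => y /negPf ya /=; rewrite ffunE ya -!val_eqE /=.
case: (ltngtP i (h y)) => [ihy|hyi|ihy]; case: (ltngtP (h y) j) => hyj;
  rewrite ?(mulrN1, mulr1, mul1r, opprB) //; lia.
Qed.

Lemma color_disc_neq0 g : injective z -> color_disc g != 0.
Proof.
move=> z_inj; rewrite prodf_seq_neq0; apply/allP => a _ /=.
rewrite prodf_seq_neq0; apply/allP => b _; apply/implyP => ab.
by rewrite subr_eq0 inj_eq //; apply: contraTneq ab => ->; rewrite ltnn.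
Qed.

(** The colorings [recolor h a j] are those that a derivation can turn into [h]. By
    [color_disc_recolor] this is, up to a common factor, a Lagrange sum over the nodes of color
    i. *)
Lemma sum_recolor h (i j : 'I_m) e :
    injective z -> (i < j)%N -> (#|fibre h j| + e < #|fibre h i|)%N ->
  \sum_(a | h a == i) z a ^+ e / color_disc (recolor h a j) =
    - (\prod_(y | (i <= h y < j)%N) (-1)) / color_disc h
      * (#|fibre h j| + e.+1 == #|fibre h i|)%:R.
Proof.
move=> z_inj ij lt_ji.
pose q := 'X^e * \prod_(y <- enum (fibre h j)) ('X - (z y)%:P).
have q_monic : q \is monic by rewrite rpredM ?monicXn ?monic_prod_XsubC.
have szq : size q = (#|fibre h j| + e).+1.
  rewrite size_monicM ?monicXn ?monic_neq0 ?monic_prod_XsubC //.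
  by rewrite size_polyXn size_prod_XsubC -cardE; lia.
(* As [q] is monic of degree at most [#|fibre h i|.-1], its coefficient there is 1 or 0 according to
   whether that degree is attained. *)
have -> : (#|fibre h j| + e.+1 == #|fibre h i|)%:R = q`_(#|fibre h i|.-1).
  case: (eqVneq (#|fibre h j| + e.+1)%N #|fibre h i|) => [<-|ne].
    by rewrite addnS /=; have /monicP := q_monic; rewrite lead_coefE szq /= => ->.
  by rewrite nth_default // szq; lia.
rewrite -(sum_lagrange z_inj) ?szq // mulr_sumr.
apply: eq_big => [a|a /eqP ha]; first by rewrite inE.
have dn := color_disc_neq0 _ z_inj.
have Ln : \prod_(y in fibre h i :\ a) (z a - z y) != 0.
  rewrite prodf_seq_neq0; apply/allP => b _; apply/implyP.
  by rewrite !inE => /andP[ba _]; rewrite subr_eq0 inj_eq // eq_sym.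
have := color_disc_recolor ij ha.
set eps : C := \prod_(y | (i <= h y < j)%N) (-1).
have eps2 : eps * eps = 1.
  by rewrite -big_split big1 // => y _ /=; rewrite mulrNN mulr1.
rewrite /q hornerM hornerXn horner_prod big_enum /=.
under [X in _ -> _ = _ * (_ * X / _)]eq_bigr do rewrite hornerXsubC.
set P := \prod_(y in fibre h j) _; set L := \prod_(y in _ :\ a) _ in Ln *.
move=> E.
have -> : (color_disc (recolor h a j))^-1 = - (P * eps) / (color_disc h * L).
  apply: (mulfI (dn (recolor h a j))).
  by rewrite divff // mulrA mulrN mulrA E opprK divff // mulf_neq0.
by field; rewrite Ln dn.
Qed.

Lemma recolor_content h a i j mu : i != j -> (0 < mu j)%N ->
  has_content mu (recolor h a j) && (h a == i) =
  has_content (fun s => mu s + (i == s) - (j == s))%N h && (h a == i).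
Proof.
move=> ij mu_j; case: eqP => ha; rewrite ?andbF // !andbT.
by apply/forallP/forallP => H s; have := H s; have := card_fibre_recolor h a j s;
  rewrite ha; case: (eqVneq j s) ij mu_j => [<-|_] => [/negPf->|_]; lia.
Qed.

(** Collect the terms by their target coloring [h] and apply [sum_recolor]. Apart from the inverse
    of [color_disc h], the coefficient depends only on the content of [h], so one constant [c] works
    for all [h]. *)
Lemma ez_op_color_sum w (i j : 'I_m) e mu :
    injective z -> (i < j)%N -> (forall a, w (k a) = z a ^+ e) ->
    (mu j + e <= (mu i).+1)%N ->
  exists2 c, (mu j + e <= mu i)%N -> c = 0 &
    ez_op w i j (color_sum mu) =
      c *: color_sum (fun s => mu s + (i == s) - (j == s))%N.
Proof.
move=> z_inj ij wE le_ji.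
have ij' : i != j by rewrite neq_ltn ij.
(* Without an index of color j the image is 0. The case is treated apart because [mu j - 1] would be
   truncated. *)
case: (posnP (mu j)) => [mu0|mu_j].
  exists 0 => //; rewrite scale0r linear_sum big1 // => g /forallP/(_ j).
  rewrite mu0 cards_eq0 => /eqP gj.
  rewrite linearZ /= ez_op_color_mon big_pred0 ?scaler0 // => a.
  by have := in_set0 a; rewrite -gj inE.
set nu := fun s => _.
(* Every target coloring has [nu s] indices of color s, so all of them share this sign. *)
pose eps : C := \prod_(s : 'I_m | (i <= s < j)%N) (-1) ^+ nu s.
exists (- eps * (mu j + e == (mu i).+1)%:R).
  by move=> le_e; rewrite ltn_eqF ?mulr0.
rewrite {1}/color_sum linear_sum /=.
under eq_bigr do rewrite linearZ /= ez_op_color_mon scaler_sumr.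
rewrite pair_big_dep /=.
(* A pair of a source g and an index a of color j in it corresponds to the pair of the target
   [recolor g a i] and the same a, now of color i. *)
rewrite (reindex_onto (fun p : {ffun 'I_n -> 'I_m} * 'I_n => (recolor p.1 p.2 j, p.2))
                      (fun p => (recolor p.1 p.2 i, p.2))) /=; last first.
  by case=> g a /= /andP[_ ga]; rewrite recolorK (eqP (_ : recolor g a j == g)) ?recolor_eq.
rewrite (eq_bigl (fun p => has_content nu p.1 && (p.1 p.2 == i))); last first.
  case=> h a /=; rewrite -recolor_content // ffunE !eqxx andbT; congr (_ && _).
  by rewrite recolorK xpair_eqE recolor_eq eqxx andbT.
rewrite -(pair_big_dep (has_content nu) (fun h a => h a == i) (fun h a =>
  (color_disc (recolor h a j))^-1 *: (w (k a) *: color_mon (recolor (recolor h a j) a i)))).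
rewrite /color_sum scaler_sumr; apply: eq_bigr => h /forallP hP /=.
have hj : (#|fibre h j| = (mu j).-1)%N by rewrite (eqP (hP j)) /nu eqxx (negPf ij'); lia.
have hi : #|fibre h i| = (mu i).+1.
  by rewrite (eqP (hP i)) /nu eqxx eq_sym (negPf ij'); lia.
have -> : eps = \prod_(y | (i <= h y < j)%N) (-1).
  rewrite (partition_big h (fun s => (i <= s < j)%N)) //=; apply: eq_bigr => s sij.
  rewrite -(eqP (hP s)) -prodr_const; apply: eq_bigl => y; rewrite inE.
  by case: eqP => [->|]; rewrite ?sij ?andbF.
under eq_bigr => a ha.
  rewrite recolorK (eqP (_ : recolor h a i == h)) ?recolor_eq // scalerA wE mulrC; over.
rewrite -scaler_suml sum_recolor //; last by rewrite hi hj; lia.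
rewrite scalerA hi hj; congr (_ *: _); rewrite mulrAC; congr (_ * _ / _).
by congr (_%:R); apply/eqP/eqP; lia.
Qed.
End Colorings.

(** * From ordered set partitions to colorings *)

Lemma Rprod_fibre (C : fieldType) (m n : nat) (z : 'I_n -> C)
    (g : {ffun 'I_n -> 'I_m}) :
  Rprod z (fibre g) = color_disc z g.
Proof.
rewrite /color_disc (partition_big g xpredT) //=; apply: eq_bigr => i _.
rewrite exchange_big /=; apply: eq_big => [a|a ai]; first by rewrite inE.
rewrite inE in ai; rewrite (partition_big g (fun j => i < j)%N) /=; last first.
  by move=> b; rewrite (eqP ai).
apply: eq_bigr => j ij; apply: eq_bigl => b; rewrite inE (eqP ai).
by case: eqP => [->|]; rewrite ?ij ?andbF.
Qed.

Lemma is_splitting_fibre (m n : nat) (mu : m.-tuple nat)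
    (g : {ffun 'I_n -> 'I_m}) :
  is_splitting mu [ffun j => fibre g j] = has_content (tnth mu) g.
Proof.
rewrite /is_splitting; have -> : [forall i, forall j, (i != j) ==>
    [disjoint [ffun j => fibre g j] i & [ffun j => fibre g j] j]].
  apply/forallP => i; apply/forallP => j; apply/implyP => ij; rewrite !ffunE.
  rewrite -setI_eq0; apply/eqP/setP => a; rewrite !inE.
  by apply/negP => /andP[/eqP-> /eqP eq_ij]; rewrite eq_ij eqxx in ij.
have -> /= : \bigcup_j [ffun j => fibre g j] j == [set: 'I_n].
  apply/eqP/setP => a; rewrite inE; apply/bigcupP; exists (g a) => //.
  by rewrite ffunE inE.
by apply: eq_forallb => j; rewrite ffunE.
Qed.

Lemma Psubst_color_sum (C : fieldType) (m N n : nat) (z : 'I_N -> C)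
    (k : 'I_n -> 'I_N) (mu : m.-tuple nat) (s0 : 'I_m) :
  Psubst z k mu = color_sum (z \o k) k (tnth mu).
Proof.
rewrite /Psubst /Ppoly linear_sum /=.
(* The inverse gives each index the block that contains it; the blocks of a splitting cover all
   indices, so the default [s0] is never taken. *)
rewrite (reindex_onto (fun g => [ffun j => fibre g j])
  (fun I => [ffun a => odflt s0 [pick j | a \in I j]])) /=; last first.
  move=> I /and3P[/forallP disj /eqP cover _]; apply/ffunP => j; rewrite ffunE.
  apply/setP => a; rewrite inE ffunE; case: pickP => [t at_|none] /=; last first.
    have : a \in \bigcup_j I j by rewrite cover inE.
    by case/bigcupP=> t _; have /= -> := none t.
  apply/eqP/idP => [<- //|aj]; apply/eqP/contraT => tj.
  have /implyP/(_ tj) := forallP (disj t) j.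
  by rewrite -setI_eq0 => /eqP/setP/(_ a); rewrite !inE at_ aj.
apply: eq_big => [g|g _].
  rewrite is_splitting_fibre; case: has_content => //=.
  apply/eqP/ffunP => a; rewrite ffunE; case: pickP => [t|/(_ (g a))].
    by rewrite ffunE inE => /eqP.
  by rewrite ffunE inE eqxx.
rewrite linearZ /= -Rprod_fibre; congr (_^-1 *: _).
  by apply: eq_bigr => i _; apply: eq_bigr => j _; rewrite !ffunE.
rewrite /color_mon (partition_big g xpredT) //= rmorph_prod; apply: eq_bigr => j _.
rewrite rmorph_prod; apply: eq_big => [a|a]; first by rewrite !ffunE inE.
rewrite ffunE inE => /eqP <- /=.
by rewrite comp_mpolyXU -tnth_nth tnth_mktuple mxvecE mxE.
Qed.

(** * Balanced partitions, and nilpotency on a single factor *)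

Section Balanced.
Local Open Scope nat_scope.

(** The explicit tuple given by division with remainder is balanced, so uniqueness identifies it
    with the chosen one. *)
Lemma tnth_balanced m (m_gt0 : 0 < m) n (i : 'I_m) :
  tnth (balanced m_gt0 n) i = n %/ m + (i < n %% m).
Proof.
pose f i := n %/ m + (i < n %% m).
have f_anti x y : x <= y -> f y <= f x by rewrite /f; lia.
have tE : tval [tuple f i | i < m] = map f (iota 0 m).
  by rewrite -val_enum_ord -map_comp.
suff /balanced_uniq/(_ (xchooseP (balanced_exists n m_gt0))) :
    is_balanced n [tuple f i | i < m].
  by rewrite /balanced => <-; rewrite tnth_mktuple.
rewrite /is_balanced /is_partition /pdiff tE; apply/and3P; split.
- by rewrite sorted_map; apply: sub_sorted (iota_sorted 0 m) => x y; apply: f_anti.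
- rewrite -tE sumnE big_tuple; under eq_bigr do rewrite tnth_mktuple.
  rewrite /f big_split /= sum_nat_const card_ord.
  rewrite [X in _ + X](_ : _ = \sum_(i < m | i < n %% m) 1); last first.
    by rewrite [RHS]big_mkcond; apply: eq_bigr => x _; case: ltnP.
  rewrite -(big_ord_widen _ (fun=> 1)) ?(ltnW (ltn_pmod n m_gt0)) //.
  by rewrite sum1_card card_ord mulnC -divn_eq.
- have -> : iota 0 m = 0 :: iota 1 m.-1 by rewrite -{1}(prednK m_gt0).
  by rewrite /= last_map /f; lia.
Qed.
End Balanced.

Lemma ez_op_color_sum_eq0 (C : fieldType) (m N n : nat) (z : 'I_n -> C)
    (k : 'I_n -> 'I_N) (w : 'I_N -> C) (i j : 'I_m) e mu :
    injective z -> (i < j)%N -> (forall a, w (k a) = z a ^+ e) ->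
    (mu j + e <= mu i)%N ->
  ez_op w i j (color_sum z k mu) = 0.
Proof.
move=> z_inj ij wE le_ji.
have [c c0 ->] := ez_op_color_sum z_inj ij wE (leqW le_ji).
by rewrite c0 ?scale0r.
Qed.

(** If [mu j < mu i], one application gives 0. If they are equal, the first application raises entry
    i and does not raise entry j, and the second one gives 0. *)
Lemma iter_ez_op_color_sum (C : fieldType) (m N n : nat) (z : 'I_n -> C)
    (k : 'I_n -> 'I_N) (w : 'I_N -> C) (i j : 'I_m) mu :
    injective z -> (i < j)%N -> (forall a, w (k a) = z a) ->
    (mu j <= mu i)%N ->
  iter (mu i <= mu j).+1 (ez_op w i j) (color_sum z k mu) = 0.
Proof.
move=> z_inj ij wE le_ji; have wE1 a : w (k a) = z a ^+ 1 by rewrite expr1.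
case: leqP => [_|lt_ji] /=; last first.
  by rewrite (ez_op_color_sum_eq0 z_inj ij wE1) ?addn1.
have [|c _ ->] := ez_op_color_sum z_inj ij wE1 (mu := mu); first by rewrite addn1.
rewrite linearZ /= (ez_op_color_sum_eq0 z_inj ij wE1) ?scaler0 // !eqxx eq_sym.
by have /negPf-> : j != i by [rewrite neq_ltn ij orbT]; lia.
Qed.

(** * Counting in admissible partitionings *)

Section Counting.
Local Open Scope nat_scope.

Lemma partitioning_count n l (U : 'I_l -> {set 'I_n}) (a : 'I_n) :
  is_partitioning U -> \sum_x (a \in U x) = 1.
Proof.
case=> disj cover; have : a \in \bigcup_x U x by rewrite cover inE.
case/bigcupP=> x _ ax; rewrite (bigD1 x) //= ax big1 // => y yx.
have := disj _ _ yx; rewrite -setI_eq0 => /eqP/setP/(_ a).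
by rewrite !inE ax andbT => ->.
Qed.

Lemma partitioning_card n l (U : 'I_l -> {set 'I_n}) :
  is_partitioning U -> \sum_x #|U x| = n.
Proof.
move=> U_part; under eq_bigr do rewrite -sum1_card big_mkcond.
rewrite exchange_big /= -[RHS]card_ord -[RHS]sum1_card; apply: eq_bigr => a _.
by rewrite -[RHS](partitioning_count a U_part); apply: eq_bigr => x _; case: (_ \in _).
Qed.

(** Computes the degree, in the variables of index [a], of the factor built on [A]. *)
Lemma sum_enum_val n (A : {set 'I_n}) (a : 'I_n) :
  \sum_(c < #|A|) (a == enum_val c) = (a \in A).
Proof.
rewrite -(big_enum_val (fun b => (a == b : nat))) big_mkcond (bigD1 a) //= eqxx.
rewrite big1 ?addn0; first by case: (_ \in _).
by move=> b /negPf; rewrite eq_sym => ->; case: ifP.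
Qed.

Lemma partition_nth m (lam : m.-tuple nat) i j :
  i <= j -> j < m -> is_partition lam -> nth 0 lam j <= nth 0 lam i.
Proof.
move=> ij jm lam_part.
have geqT : transitive geq by move=> x y t /= xy yt; apply: leq_trans yt xy.
by apply: (sorted_leq_nth geqT leqnn 0 lam_part);
  rewrite ?inE ?size_tuple ?(leq_ltn_trans ij).
Qed.

(** By admissibility the weights of the product have the same consecutive differences as [lam]; the
    totals agree as well, hence so do the entries. *)
Lemma admissible_weight m (m_gt0 : 0 < m) (lam : m.-tuple nat) l
    (U : 'I_l -> {set 'I_(sumn lam)}) (i : 'I_m) :
    is_partition lam -> admissible lam U ->
  \sum_x tnth (balanced m_gt0 #|U x|) i = tnth lam i.
Proof.
move=> lam_part [U_part U_adm].
pose w t := \sum_x (#|U x| %/ m + (t < #|U x| %% m)).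
have step t : t.+1 < m -> w t + nth 0 lam t.+1 = w t.+1 + nth 0 lam t.
  move=> tm; have le_t := partition_nth (leqnSn t) tm lam_part.
  (* Counting from 0, entries t and t + 1 of a balanced partition differ, by one, exactly when its
     total is t + 1 modulo m. *)
  have -> : w t = w t.+1 + #|[set x | #|U x| == t.+1 %[mod m]]|.
    rewrite -sum1_card [X in _ + X]big_mkcond -big_split; apply: eq_bigr => x _.
    by rewrite inE (modn_small tm) /=; case: eqP; lia.
  (* Entry t + 1 of the extended partition is entry t of [lam]. *)
  by rewrite U_adm //= ; lia.
have shift t : t < m -> w t + nth 0 lam 0 = w 0 + nth 0 lam t.
  by elim: t => // t IH tm; have := IH (ltnW tm); have := step t tm; lia.
have sum_w : \sum_(t < m) w t = \sum_(t < m) nth 0 lam t.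
  have -> : \sum_(t < m) nth 0 lam t = sumn lam.
    by rewrite sumnE big_tuple; apply: eq_bigr => t _; rewrite (tnth_nth 0).
  rewrite -[RHS](partitioning_card U_part) exchange_big; apply: eq_bigr => x _.
  have /and3P[_ /eqP sum_mu _] := xchooseP (balanced_exists #|U x| m_gt0).
  rewrite -[RHS]sum_mu [RHS]sumnE [RHS]big_tuple; apply: eq_bigr => t _.
  by rewrite -/(balanced m_gt0 #|U x|) tnth_balanced.
(* Summing [shift] over all t and cancelling the equal totals leaves m times the claim. *)
have w0 : w 0 = nth 0 lam 0.
  have : \sum_(t < m) (w t + nth 0 lam 0) = \sum_(t < m) (w 0 + nth 0 lam t).
    by apply: eq_bigr => t _; apply: shift.
  rewrite !big_split /= sum_w addnC => /addIn/eqP.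
  by rewrite !sum_nat_const card_ord eqn_pmul2l // => /eqP.
rewrite (tnth_nth 0); have := shift i (ltn_ord i).
by rewrite w0 addnC => /addnI <-; apply: eq_bigr => x _; rewrite tnth_balanced.
Qed.

End Counting.

Theorem proposition6p3 (R : realType) (m : nat) (m_ge2 : (2 <= m)%N)
    (lam : m.-tuple nat) (lam_part : is_partition lam)
    (l : nat) (l_gt0 : (0 < l)%N) (l_ge : (pdiff lam <= l)%N)
    (z : 'I_(sumn lam) -> R[i]) (z_inj : injective z)
    (U : 'I_l -> {set 'I_(sumn lam)}) (U_adm : admissible lam U) :
  in_CB m_ge2 l z lam (Qpoly m_ge2 z U).
Proof.
pose mu x := tnth (balanced (ltnW m_ge2) #|U x|).
pose z_ x (a : 'I_#|U x|) := z (enum_val a).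
have z_inj_ x : injective (z_ x) by move=> a b /z_inj /enum_val_inj.
have mu_anti x (i j : 'I_m) : (i < j)%N -> (mu x j <= mu x i)%N.
  by rewrite /mu !tnth_balanced; lia.
have QE : Qpoly m_ge2 z U = \prod_x color_sum (z_ x) enum_val (mu x).
  by apply: eq_bigr => x _; rewrite (Psubst_color_sum _ _ _ (first_idx m_ge2)).
have first_lt_last : (first_idx m_ge2 < last_idx m_ge2)%N by rewrite /=; lia.
rewrite QE; split; first split.
(* Each index lies in exactly one [U x], so the degrees of the factors add up to 1. *)
- move=> a mon mon_Q.
  have /= -> := has_degrees_prod
    (fun x => @has_degrees_color_sum _ _ _ _ (z_ x) enum_val (mu x)) a mon_Q.
  rewrite -(partitioning_count a U_adm.1); apply: eq_bigr => x _.
  by rewrite sum_enum_val.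
- move=> i j ij; rewrite e_opE; apply: ez_op_prod_eq0 => x.
  by apply: (ez_op_color_sum_eq0 (e := 0)); rewrite // addn0 mu_anti.
- move=> i; rewrite e_opE.
  rewrite (ez_op_prod_eigen _ (fun x => ez_op_color_sum_diag (z_ x) enum_val i (mu x))).
  by rewrite -natr_sum admissible_weight.
have -> : (l - pdiff lam + 1)%N =
    (\sum_x (mu x (first_idx m_ge2) <= mu x (last_idx m_ge2))%N).+1.
  rewrite addn1; congr _.+1.
  (* The first and last entries of a balanced partition agree exactly when m divides its total;
     admissibility with j = 0 counts the sets of such size. *)
  transitivity #|[set x | #|U x| == 0 %[mod m]]|.
    rewrite U_adm.2 ?(ltnW m_ge2) // /pdiff /=.
    (* Since lambda_m <= lambda_1, the truncated differences l + lambda_m - lambda_1 and l -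
       (lambda_1 - lambda_m) agree. *)
    have := partition_nth (leq0n m.-1) (last_idx_subproof m_ge2) lam_part.
    have := nth_last 0%N lam; rewrite size_tuple nth0 => ->.
    move: l_ge; rewrite /pdiff -nth0 /=; lia.
  rewrite -sum1_card big_mkcond; apply: eq_bigr => x _.
  rewrite inE mod0n /mu !tnth_balanced /=.
  have := ltn_pmod #|U x| (ltnW m_ge2); case: eqP; lia.
by apply: iter_ez_op_prod => x; apply: iter_ez_op_color_sum => //; apply: mu_anti.
Qed.
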